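(* Let $\Bbbk$ be a field. For any Hopf quasigroup $H$ over $\Bbbk$, the category of right $H$-Hopf modules and the category of left $H$-Hopf modules are each equivalent to the category of $\Bbbk$-vector spaces.
   Context: All tensor products are over the field $\Bbbk$; the identity map on a vector space $V$ is denoted by $V$. Hopf quasigroup: a vector space $H$ that is a unital (not necessarily associative) algebra with product $\mu$ (written as juxtaposition) and unit $1$, and a coassociative counital coalgebra with coproduct $\Delta(h)=h_{(1)}\otimes h_{(2)}$ (Sweedler notation) and counit $\varepsilon$, such that $\Delta,\varepsilon$ are (unital) algebra homomorphisms and there is a linear map $S:H\to H$ (the antipode) with, for all $g,h\in H$, $S(h_{(1)})(h_{(2)}g)=\varepsilon(h)g=h_{(1)}(S(h_{(2)})g)$ and $(gh_{(1)})S(h_{(2)})=g\,\varepsilon(h)=(gS(h_{(1)}))h_{(2)}$. Right $H$-Hopf module: a vector space $M$ that is a coassociative counital right $H$-comodule with coaction $\varrho^M:M\to M\otimes H$, $m\mapsto m_{(0)}\otimes m_{(1)}$, together with a linear map $\varrho_M:M\otimes H\to M$, $m\otimes h\mapsto m\cdot h$ that is unital ($m\cdot 1=m$) but not necessarily associative, such that for all $m\in M$, $h\in H$: $(m\cdot h_{(1)})\cdot S(h_{(2)})=m\,\varepsilon(h)=(m\cdot S(h_{(1)}))\cdot h_{(2)}$ and $\varrho^M(m\cdot h)=m_{(0)}\cdot h_{(1)}\otimes m_{(1)}h_{(2)}$. Induced action: for a right $H$-Hopf module $M$, $\widehat{\varrho}_M:M\otimes H\to M$, $\widehat{\varrho}_M(m\otimes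 h)=(m_{(0)}\cdot S(m_{(1)}))\cdot(m_{(2)}h)$, where $m_{(0)}\otimes m_{(1)}\otimes m_{(2)}=(M\otimes\Delta)\varrho^M(m)$. A linear map $f:M\to N$ between right $H$-Hopf modules is $H$-quasilinear if $f\circ\widehat{\varrho}_M=\widehat{\varrho}_N\circ(f\otimes H)$. The category of right $H$-Hopf modules has as morphisms the linear maps that are both right $H$-colinear and $H$-quasilinear. The category of left $H$-Hopf modules is defined symmetrically: objects are coassociative counital left $H$-comodules $M$, $m\mapsto m_{(-1)}\otimes m_{(0)}$, with a unital (not necessarily associative) left action $h\otimes m\mapsto h\cdot m$ such that $S(h_{(1)})\cdot(h_{(2)}\cdot m)=\varepsilon(h)m=h_{(1)}\cdot(S(h_{(2)})\cdot m)$ and the coaction sends $h\cdot m$ to $h_{(1)}m_{(-1)}\otimes h_{(2)}\cdot m_{(0)}$; morphisms are left $H$-colinear maps commuting with the induced left actions $h\otimes m\mapsto(hm_{(-2)})\cdot(S(m_{(-1)})\cdot m_{(0)})$, where $m_{(-2)}\otimes m_{(-1)}\otimes m_{(0)}$ denotes the iterated coaction. *)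

(* Defs.v *)
From HB Require Import structures.
From mathcomp Require Import all_boot all_algebra.
From mathcomp Require Import boolp.

Set Implicit Arguments.
Unset Strict Implicit.
Unset Printing Implicit Defensive.

Import GRing.Theory.
Local Open Scope ring_scope.
Local Open Scope quotient_scope.

(* MathComp has no tensor product of arbitrary (possibly infinite-dimensional)
   vector spaces.  An element of V ⨂ W is represented by a formal sum
   [:: (v1, w1); ...; (vn, wn)], standing for v1 ⊗ w1 + ... + vn ⊗ wn; two
   formal sums are identified when no bilinear map separates them.  The
   universal property is proved below (tlift_tens, tlift_is_linear,
   tensor_ext). *)

Section TensorProduct.
Variables (K : fieldType) (V W : lmodType K).

Definition is_bilinear (U : lmodType K) (F : V -> W -> U) : Prop :=
  bilinear_for *:%R *:%R F.

Definition tens_eval (U : nmodType) (F : V -> W -> U) (s : seq (V * W)) : U :=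
  \sum_(p <- s) F p.1 p.2.

Definition tens_equiv (s t : seq (V * W)) : bool :=
  `[< forall (U : lmodType K) (F : V -> W -> U), is_bilinear F ->
        tens_eval F s = tens_eval F t >].

Lemma tens_equiv_refl : reflexive tens_equiv.
Proof. by move=> s; apply/asboolP. Qed.

Lemma tens_equiv_sym : symmetric tens_equiv.
Proof.
by move=> s t; apply/asboolP/asboolP => h U F bF; rewrite (h U F bF).
Qed.

Lemma tens_equiv_trans : transitive tens_equiv.
Proof.
move=> t s r /asboolP h1 /asboolP h2; apply/asboolP => U F bF.
by rewrite h1 // h2.
Qed.

Canonical tens_equiv_rel :=
  EquivRel tens_equiv tens_equiv_refl tens_equiv_sym tens_equiv_trans.

Definition tensor : Type := {eq_quot tens_equiv}.

HB.instance Definition _ : EqQuotient _ tens_equiv tensor :=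
  EqQuotient.on tensor.
HB.instance Definition _ := Choice.on tensor.

Definition tens_scale_seq (a : K) (s : seq (V * W)) :=
  [seq (a *: p.1, p.2) | p <- s].

Definition tens_zero : tensor := \pi_tensor [::].
Definition tens_add (x y : tensor) : tensor := \pi_tensor (repr x ++ repr y).
Definition tens_scale (a : K) (x : tensor) : tensor :=
  \pi_tensor (tens_scale_seq a (repr x)).
Definition tens_opp (x : tensor) : tensor := tens_scale (-1) x.

Lemma tens_piP (s t : seq (V * W)) :
  (forall (U : lmodType K) (F : V -> W -> U), is_bilinear F ->
     tens_eval F s = tens_eval F t) -> \pi_tensor s = \pi_tensor t.
Proof. by move=> h; apply/eqmodP/asboolP. Qed.

Lemma tens_eval_repr_pi (U : lmodType K) (F : V -> W -> U) s :
  is_bilinear F -> tens_eval F (repr (\pi_tensor s)) = tens_eval F s.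
Proof.
move=> bF; have : \pi_tensor (repr (\pi_tensor s)) = \pi_tensor s by rewrite reprK.
by move=> /eqmodP/asboolP; apply.
Qed.

Lemma tens_eval_cat (U : nmodType) (F : V -> W -> U) s t :
  tens_eval F (s ++ t) = tens_eval F s + tens_eval F t.
Proof. exact: big_cat. Qed.

Lemma tens_eval_scale (U : lmodType K) (F : V -> W -> U) a s :
  is_bilinear F -> tens_eval F (tens_scale_seq a s) = a *: tens_eval F s.
Proof.
move=> [Fl _]; rewrite /tens_eval /tens_scale_seq big_map scaler_sumr.
by apply: eq_bigr => p _ /=; rewrite (scalable_linear (Fl p.2)).
Qed.

Lemma tens_eq (x y : tensor) :
  (forall (U : lmodType K) (F : V -> W -> U), is_bilinear F ->
     tens_eval F (repr x) = tens_eval F (repr y)) -> x = y.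
Proof. by move=> h; rewrite -(reprK x) -(reprK y); apply: tens_piP. Qed.

Lemma tens_eval_add (U : lmodType K) (F : V -> W -> U) x y : is_bilinear F ->
  tens_eval F (repr (tens_add x y)) =
  tens_eval F (repr x) + tens_eval F (repr y).
Proof. by move=> bF; rewrite tens_eval_repr_pi // tens_eval_cat. Qed.

Lemma tens_eval_scaler (U : lmodType K) (F : V -> W -> U) a x : is_bilinear F ->
  tens_eval F (repr (tens_scale a x)) = a *: tens_eval F (repr x).
Proof. by move=> bF; rewrite tens_eval_repr_pi // tens_eval_scale. Qed.

Lemma tens_eval_zero (U : lmodType K) (F : V -> W -> U) : is_bilinear F ->
  tens_eval F (repr tens_zero) = 0.
Proof. by move=> bF; rewrite tens_eval_repr_pi // /tens_eval big_nil. Qed.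

Lemma tens_addA : associative tens_add.
Proof. by move=> x y z; apply: tens_eq => U F bF; rewrite !tens_eval_add ?addrA. Qed.

Lemma tens_addC : commutative tens_add.
Proof. by move=> x y; apply: tens_eq => U F bF; rewrite !tens_eval_add // addrC. Qed.

Lemma tens_add0 : left_id tens_zero tens_add.
Proof.
by move=> x; apply: tens_eq => U F bF; rewrite tens_eval_add ?tens_eval_zero ?add0r.
Qed.

Lemma tens_addN : left_inverse tens_zero tens_opp tens_add.
Proof.
move=> x; apply: tens_eq => U F bF.
by rewrite tens_eval_add // tens_eval_scaler // tens_eval_zero // scaleN1r addNr.
Qed.

HB.instance Definition _ :=
  GRing.isZmodule.Build tensor tens_addA tens_addC tens_add0 tens_addN.

Lemma tens_scaleA a b x : tens_scale a (tens_scale b x) = tens_scale (a * b) x.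
Proof. by apply: tens_eq => U F bF; rewrite !tens_eval_scaler ?scalerA. Qed.

Lemma tens_scale1 : left_id 1 tens_scale.
Proof. by move=> x; apply: tens_eq => U F bF; rewrite tens_eval_scaler ?scale1r. Qed.

Lemma tens_scaleDr : right_distributive tens_scale +%R.
Proof.
move=> a x y; apply: tens_eq => U F bF.
by rewrite tens_eval_scaler ?tens_eval_add ?tens_eval_scaler ?scalerDr.
Qed.

Lemma tens_scaleDl x : {morph tens_scale^~ x : a b / a + b}.
Proof.
move=> a b; apply: tens_eq => U F bF.
by rewrite tens_eval_scaler ?tens_eval_add ?tens_eval_scaler ?scalerDl.
Qed.

HB.instance Definition _ := GRing.Zmodule_isLmodule.Build K tensor
  tens_scaleA tens_scale1 tens_scaleDr tens_scaleDl.

Definition tens (v : V) (w : W) : tensor := \pi_tensor [:: (v, w)].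

(* For a bilinear F, this is the linear map V ⨂ W -> U induced by F; its value
   does not depend on the chosen representative. *)
Definition tlift (U : nmodType) (F : V -> W -> U) (x : tensor) : U :=
  \sum_(p <- repr x) F p.1 p.2.

Lemma tens_is_bilinear : is_bilinear tens.
Proof.
split=> [w a v v'|v a w w'] /=; apply: tens_eq => U F bF;
  rewrite [RHS]tens_eval_add ?tens_eval_scaler ?tens_eval_repr_pi //;
  by rewrite /tens_eval !big_seq1 /= ?(bF.1 w) ?(bF.2 v).
Qed.

Lemma tensPl a v v' w :
  tens (a *: v + v') w = a *: tens v w + tens v' w.
Proof. exact: tens_is_bilinear.1. Qed.

Lemma tensPr a v w w' :
  tens v (a *: w + w') = a *: tens v w + tens v w'.
Proof. exact: tens_is_bilinear.2. Qed.

HB.instance Definition _ :=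
  bilinear_isBilinear.Build K V W tensor *:%R *:%R tens tens_is_bilinear.

Lemma tlift_tens (U : lmodType K) (F : V -> W -> U) v w :
  is_bilinear F -> tlift F (tens v w) = F v w.
Proof.
by move=> bF; rewrite /tlift -/(tens_eval F _) tens_eval_repr_pi // /tens_eval big_seq1.
Qed.

Lemma tlift_is_linear (U : lmodType K) (F : V -> W -> U) :
  is_bilinear F -> linear (tlift F).
Proof.
move=> bF a x y; rewrite /tlift -!/(tens_eval F _).
by rewrite [LHS]tens_eval_add // tens_eval_scaler.
Qed.

Lemma tensE (x : tensor) : x = \sum_(p <- repr x) tens p.1 p.2.
Proof.
suff h (s : seq (V * W)) : \pi_tensor s = \sum_(p <- s) tens p.1 p.2.
  by rewrite -[LHS]reprK h.
elim: s => [|[v w] s IHs]; first by rewrite big_nil.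
rewrite big_cons -IHs; apply: tens_eq => U F bF.
by rewrite [RHS]tens_eval_add ?tens_eval_repr_pi // -tens_eval_cat.
Qed.

Lemma tensor_ext (U : lmodType K) (f g : {linear tensor -> U}) :
  (forall v w, f (tens v w) = g (tens v w)) -> f =1 g.
Proof.
move=> fg x; rewrite (tensE x) !linear_sum; apply: eq_bigr => p _; exact: fg.
Qed.

End TensorProduct.

Notation "V ⨂ W" := (tensor V W)
  (at level 40, left associativity).
Notation "v ⊗ w" := (tens v w)
  (at level 40, left associativity) : ring_scope.

(* Sweedler notation: \sw_(x, y <- t) E is the sum of the E(x_i, y_i) over a
   decomposition t = sum_i x_i ⊗ y_i.  It is only used with E bilinear in
   (x, y), so that the choice of decomposition is irrelevant. *)
Notation "\sw_ ( x , y <- t ) E" := (tlift (fun x y => E) t)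
  (at level 36, E at level 36, x name, y name, t at level 200,
   format "\sw_ ( x ,  y  <-  t )  E") : ring_scope.

Section TensorMap.
Variables (K : fieldType) (V V' W W' : lmodType K).
Variables (f : {linear V -> V'}) (g : {linear W -> W'}).

Definition tmap (x : V ⨂ W) : V' ⨂ W' := \sw_(v, w <- x) (f v ⊗ g w).

Lemma tmap_is_bilinear : is_bilinear (fun v w => f v ⊗ g w).
Proof.
by split=> [w a v v'|v a w w'] /=; rewrite linearP ?tensPl ?tensPr.
Qed.

HB.instance Definition _ := GRing.isLinear.Build K
  (V ⨂ W) (V' ⨂ W') *:%R tmap
  (tlift_is_linear tmap_is_bilinear).

Lemma tmap_tens v w : tmap (v ⊗ w) = f v ⊗ g w.
Proof. exact: tlift_tens tmap_is_bilinear. Qed.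

End TensorMap.

Lemma tmap_id (K : fieldType) (V W : lmodType K) (x : V ⨂ W) :
  tmap idfun idfun x = x.
Proof. by rewrite [RHS]tensE. Qed.

Lemma tmap_comp (K : fieldType) (V V' V'' W W' W'' : lmodType K)
    (f : {linear V' -> V''}) (f' : {linear V -> V'})
    (g : {linear W' -> W''}) (g' : {linear W -> W'}) (x : V ⨂ W) :
  tmap f g (tmap f' g' x) = tmap (f \o f') (g \o g') x.
Proof.
rewrite {1}/(tmap f' g') /tlift linear_sum; apply: eq_bigr => p _ /=.
exact: tmap_tens.
Qed.

Section Associator.
Variables (K : fieldType) (U V W : lmodType K).

Definition tassoc (t : (U ⨂ V) ⨂ W) : U ⨂ (V ⨂ W) :=
  \sw_(x, w <- t) \sw_(u, v <- x) (u ⊗ (v ⊗ w)).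

Lemma tassoc_inner_is_bilinear w :
  is_bilinear (fun u v => u ⊗ (v ⊗ w) : U ⨂ (V ⨂ W)).
Proof. by split=> [v a u u'|u a v v'] /=; rewrite ?tensPl ?tensPr. Qed.

Lemma tassoc_outer_is_bilinear :
  is_bilinear (fun (x : U ⨂ V) (w : W) => \sw_(u, v <- x) (u ⊗ (v ⊗ w))).
Proof.
split=> [w a x y|x a w w'] /=.
  exact: tlift_is_linear (tassoc_inner_is_bilinear w) a x y.
rewrite /tlift scaler_sumr -big_split; apply: eq_bigr => p _ /=.
by rewrite !tensPr.
Qed.

Lemma tassoc_is_linear : linear tassoc.
Proof. exact: tlift_is_linear tassoc_outer_is_bilinear. Qed.

Lemma tassoc_tens u v w : tassoc ((u ⊗ v) ⊗ w) = u ⊗ (v ⊗ w).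
Proof.
rewrite /tassoc (tlift_tens _ _ tassoc_outer_is_bilinear).
exact: tlift_tens (tassoc_inner_is_bilinear w).
Qed.

HB.instance Definition _ := GRing.isLinear.Build K
  ((U ⨂ V) ⨂ W) (U ⨂ (V ⨂ W)) *:%R tassoc tassoc_is_linear.

End Associator.

Section HopfQuasigroup.
Variable K : fieldType.

Record hopfQuasigroup := HopfQuasigroup {
  hq_space :> lmodType K;
  hq_mul : {linear hq_space ⨂ hq_space -> hq_space};
  hq_one : hq_space;
  hq_comul : {linear hq_space -> hq_space ⨂ hq_space};
  hq_counit : {scalar hq_space};
  hq_antipode : {linear hq_space -> hq_space};
  hq_mul1h : forall h, hq_mul (hq_one ⊗ h) = h;
  hq_mulh1 : forall h, hq_mul (h ⊗ hq_one) = h;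
  hq_coassoc : forall h,
    tassoc (tmap hq_comul idfun (hq_comul h)) =
    tmap idfun hq_comul (hq_comul h);
  hq_counitl : forall h, \sw_(h1, h2 <- hq_comul h) (hq_counit h1 *: h2) = h;
  hq_counitr : forall h, \sw_(h1, h2 <- hq_comul h) (hq_counit h2 *: h1) = h;
  hq_comul1 : hq_comul hq_one = hq_one ⊗ hq_one;
  hq_comulM : forall g h,
    hq_comul (hq_mul (g ⊗ h)) =
    \sw_(g1, g2 <- hq_comul g) \sw_(h1, h2 <- hq_comul h)
      (hq_mul (g1 ⊗ h1) ⊗ hq_mul (g2 ⊗ h2));
  hq_counit1 : hq_counit hq_one = 1;
  hq_counitM : forall g h,
    hq_counit (hq_mul (g ⊗ h)) = hq_counit g * hq_counit h;
  hq_antipodeKl : forall g h,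
    \sw_(h1, h2 <- hq_comul h) hq_mul (hq_antipode h1 ⊗ hq_mul (h2 ⊗ g)) =
    hq_counit h *: g;
  hq_antipodeVKl : forall g h,
    \sw_(h1, h2 <- hq_comul h) hq_mul (h1 ⊗ hq_mul (hq_antipode h2 ⊗ g)) =
    hq_counit h *: g;
  hq_antipodeKr : forall g h,
    \sw_(h1, h2 <- hq_comul h) hq_mul (hq_mul (g ⊗ h1) ⊗ hq_antipode h2) =
    hq_counit h *: g;
  hq_antipodeVKr : forall g h,
    \sw_(h1, h2 <- hq_comul h) hq_mul (hq_mul (g ⊗ hq_antipode h1) ⊗ h2) =
    hq_counit h *: g
}.

End HopfQuasigroup.

Record category := Category {
  obj :> Type;
  hom : obj -> obj -> Type;
  cid : forall a, hom a a;
  ccomp : forall x y z, hom y z -> hom x y -> hom x z;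
  ccomp1f : forall a b (f : hom a b), ccomp (cid b) f = f;
  ccompf1 : forall a b (f : hom a b), ccomp f (cid a) = f;
  ccompA : forall a b c d (f : hom c d) (g : hom b c) (h : hom a b),
    ccomp f (ccomp g h) = ccomp (ccomp f g) h
}.

Arguments hom {_} _ _.
Arguments cid {_} _.
Arguments ccomp {_} [x y z] _ _.

Record functor (C D : category) := Functor {
  fobj :> C -> D;
  fmap : forall a b : C, hom a b -> hom (fobj a) (fobj b);
  fmap1 : forall a : C, fmap (cid a) = cid (fobj a);
  fmapM : forall (a b c : C) (f : hom b c) (g : hom a b),
    fmap (ccomp f g) = ccomp (fmap f) (fmap g)
}.

Arguments fmap {C D} _ [a b] _.

Definition functor_id (C : category) : functor C C :=
  @Functor C C (fun a => a) (fun _ _ f => f)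
    (fun _ => erefl) (fun _ _ _ _ _ => erefl).

Section FunctorComp.
Variables (C D E : category) (G : functor D E) (F : functor C D).

Lemma functor_comp_fmap1 (a : C) : fmap G (fmap F (cid a)) = cid (G (F a)).
Proof. by rewrite !fmap1. Qed.

Lemma functor_comp_fmapM (a b c : C) (f : hom b c) (g : hom a b) :
  fmap G (fmap F (ccomp f g)) = ccomp (fmap G (fmap F f)) (fmap G (fmap F g)).
Proof. by rewrite !fmapM. Qed.

Definition functor_comp : functor C E :=
  @Functor C E (fun a => G (F a)) (fun a b f => fmap G (fmap F f))
    functor_comp_fmap1 functor_comp_fmapM.

End FunctorComp.

Record nat_iso (C D : category) (F G : functor C D) := NatIso {
  nat_fwd : forall a : C, hom (F a) (G a);
  nat_bwd : forall a : C, hom (G a) (F a);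
  nat_natural : forall (a b : C) (f : hom a b),
    ccomp (fmap G f) (nat_fwd a) = ccomp (nat_fwd b) (fmap F f);
  nat_fwdK : forall a : C, ccomp (nat_bwd a) (nat_fwd a) = cid (F a);
  nat_bwdK : forall a : C, ccomp (nat_fwd a) (nat_bwd a) = cid (G a)
}.

Definition equivalent_categories (C D : category) : Prop :=
  exists (F : functor C D) (G : functor D C),
    inhabited (nat_iso (functor_comp G F) (functor_id C)) /\
    inhabited (nat_iso (functor_comp F G) (functor_id D)).

Section VectorSpaces.
Variable K : fieldType.

Lemma linear_map_ext (V W : lmodType K) (f g : {linear V -> W}) :
  f =1 g -> f = g.
Proof.
case: f g => [f cf] [g cg] /= fg.
have {}fg : f = g by apply: funext.
case: _ / fg in cg *; congr GRing.Linear.Pack.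
case: cf cg => [[a] [b]] [[c] [d]].
by congr GRing.Linear.Class; [congr GRing.isNmodMorphism.Axioms_
  | congr GRing.isScalable.Axioms_].
Qed.

Definition lin_id (V : lmodType K) : {linear V -> V} := idfun.
Definition lin_comp (U V W : lmodType K)
  (f : {linear V -> W}) (g : {linear U -> V}) : {linear U -> W} := f \o g.

Lemma lin_comp1f (V W : lmodType K) (f : {linear V -> W}) :
  lin_comp (lin_id W) f = f.
Proof. exact: linear_map_ext. Qed.

Lemma lin_compf1 (V W : lmodType K) (f : {linear V -> W}) :
  lin_comp f (lin_id V) = f.
Proof. exact: linear_map_ext. Qed.

Lemma lin_compA (V1 V2 V3 V4 : lmodType K) (f : {linear V3 -> V4})
    (g : {linear V2 -> V3}) (h : {linear V1 -> V2}) :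
  lin_comp f (lin_comp g h) = lin_comp (lin_comp f g) h.
Proof. exact: linear_map_ext. Qed.

Definition vectCat : category :=
  Category lin_comp1f lin_compf1 lin_compA.

End VectorSpaces.

Section RightHopfModules.
Variables (K : fieldType) (H : hopfQuasigroup K).

Record rightHopfModule := RightHopfModule {
  rhm_space :> lmodType K;
  rhm_coact : {linear rhm_space -> rhm_space ⨂ H};
  rhm_act : {linear rhm_space ⨂ H -> rhm_space};
  rhm_coassoc : forall m,
    tassoc (tmap rhm_coact idfun (rhm_coact m)) =
    tmap idfun (hq_comul H) (rhm_coact m);
  rhm_counit : forall m,
    \sw_(m0, m1 <- rhm_coact m) (hq_counit H m1 *: m0) = m;
  rhm_act1 : forall m, rhm_act (m ⊗ hq_one H) = m;
  rhm_actK : forall m h,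
    \sw_(h1, h2 <- hq_comul H h)
      rhm_act (rhm_act (m ⊗ h1) ⊗ hq_antipode H h2) =
    hq_counit H h *: m;
  rhm_actVK : forall m h,
    \sw_(h1, h2 <- hq_comul H h)
      rhm_act (rhm_act (m ⊗ hq_antipode H h1) ⊗ h2) =
    hq_counit H h *: m;
  rhm_coactM : forall m h,
    rhm_coact (rhm_act (m ⊗ h)) =
    \sw_(m0, m1 <- rhm_coact m) \sw_(h1, h2 <- hq_comul H h)
      (rhm_act (m0 ⊗ h1) ⊗ hq_mul H (m1 ⊗ h2))
}.

Definition rhm_induced (M : rightHopfModule) (m : M) (h : H) : M :=
  \sw_(m0, x <- tmap idfun (hq_comul H) (rhm_coact M m)) \sw_(m1, m2 <- x)
    rhm_act M (rhm_act M (m0 ⊗ hq_antipode H m1) ⊗ hq_mul H (m2 ⊗ h)).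

Definition right_colinear (M N : rightHopfModule) (f : {linear M -> N}) : Prop :=
  forall m, rhm_coact N (f m) = tmap f idfun (rhm_coact M m).

Definition right_quasilinear (M N : rightHopfModule) (f : {linear M -> N}) :
  Prop := forall m h, f (rhm_induced m h) = rhm_induced (f m) h.

Record rhm_hom (M N : rightHopfModule) := RhmHom {
  rhm_fun :> {linear M -> N};
  rhm_funC : right_colinear rhm_fun;
  rhm_funQ : right_quasilinear rhm_fun
}.

Lemma rhm_hom_ext (M N : rightHopfModule) (f g : rhm_hom M N) :
  rhm_fun f = rhm_fun g -> f = g.
Proof.
case: f g => [f cf qf] [g cg qg] /= fg.
by case: _ / fg in cg qg *; congr RhmHom.
Qed.

Lemma rhm_id_colinear (M : rightHopfModule) : right_colinear (lin_id M).
Proof. by move=> m; rewrite (tmap_id (rhm_coact M m)). Qed.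

Lemma rhm_id_quasilinear (M : rightHopfModule) :
  right_quasilinear (lin_id M).
Proof. by []. Qed.

Definition rhm_id (M : rightHopfModule) : rhm_hom M M :=
  RhmHom (@rhm_id_colinear M) (@rhm_id_quasilinear M).

Section Composition.
Variables (M N P : rightHopfModule) (f : rhm_hom N P) (g : rhm_hom M N).

Lemma rhm_comp_colinear : right_colinear (lin_comp f g).
Proof.
move=> m /=; rewrite (rhm_funC f) (rhm_funC g).
exact: (tmap_comp f g (lin_id H) (lin_id H)).
Qed.

Lemma rhm_comp_quasilinear : right_quasilinear (lin_comp f g).
Proof. by move=> m h /=; rewrite (rhm_funQ g) (rhm_funQ f). Qed.

Definition rhm_comp : rhm_hom M P :=
  RhmHom rhm_comp_colinear rhm_comp_quasilinear.

End Composition.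

Lemma rhm_comp1f (M N : rightHopfModule) (f : rhm_hom M N) :
  rhm_comp (rhm_id N) f = f.
Proof. by apply: rhm_hom_ext; exact: lin_comp1f. Qed.

Lemma rhm_compf1 (M N : rightHopfModule) (f : rhm_hom M N) :
  rhm_comp f (rhm_id M) = f.
Proof. by apply: rhm_hom_ext; exact: lin_compf1. Qed.

Lemma rhm_compA (M1 M2 M3 M4 : rightHopfModule) (f : rhm_hom M3 M4)
    (g : rhm_hom M2 M3) (h : rhm_hom M1 M2) :
  rhm_comp f (rhm_comp g h) = rhm_comp (rhm_comp f g) h.
Proof. by apply: rhm_hom_ext; exact: lin_compA. Qed.

Definition rightHopfModCat : category :=
  Category rhm_comp1f rhm_compf1 rhm_compA.

End RightHopfModules.

Section LeftHopfModules.
Variables (K : fieldType) (H : hopfQuasigroup K).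

Record leftHopfModule := LeftHopfModule {
  lhm_space :> lmodType K;
  lhm_coact : {linear lhm_space -> H ⨂ lhm_space};
  lhm_act : {linear H ⨂ lhm_space -> lhm_space};
  lhm_coassoc : forall m,
    tassoc (tmap (hq_comul H) idfun (lhm_coact m)) =
    tmap idfun lhm_coact (lhm_coact m);
  lhm_counit : forall m,
    \sw_(m1, m0 <- lhm_coact m) (hq_counit H m1 *: m0) = m;
  lhm_act1 : forall m, lhm_act (hq_one H ⊗ m) = m;
  lhm_actK : forall h m,
    \sw_(h1, h2 <- hq_comul H h)
      lhm_act (hq_antipode H h1 ⊗ lhm_act (h2 ⊗ m)) =
    hq_counit H h *: m;
  lhm_actVK : forall h m,
    \sw_(h1, h2 <- hq_comul H h)
      lhm_act (h1 ⊗ lhm_act (hq_antipode H h2 ⊗ m)) =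
    hq_counit H h *: m;
  lhm_coactM : forall h m,
    lhm_coact (lhm_act (h ⊗ m)) =
    \sw_(h1, h2 <- hq_comul H h) \sw_(m1, m0 <- lhm_coact m)
      (hq_mul H (h1 ⊗ m1) ⊗ lhm_act (h2 ⊗ m0))
}.

Definition lhm_induced (M : leftHopfModule) (h : H) (m : M) : M :=
  \sw_(x, m0 <- tmap (hq_comul H) idfun (lhm_coact M m)) \sw_(m2, m1 <- x)
    lhm_act M (hq_mul H (h ⊗ m2) ⊗ lhm_act M (hq_antipode H m1 ⊗ m0)).

Definition left_colinear (M N : leftHopfModule) (f : {linear M -> N}) : Prop :=
  forall m, lhm_coact N (f m) = tmap idfun f (lhm_coact M m).

Definition left_quasilinear (M N : leftHopfModule) (f : {linear M -> N}) :
  Prop := forall h m, f (lhm_induced h m) = lhm_induced h (f m).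

Record lhm_hom (M N : leftHopfModule) := LhmHom {
  lhm_fun :> {linear M -> N};
  lhm_funC : left_colinear lhm_fun;
  lhm_funQ : left_quasilinear lhm_fun
}.

Lemma lhm_hom_ext (M N : leftHopfModule) (f g : lhm_hom M N) :
  lhm_fun f = lhm_fun g -> f = g.
Proof.
case: f g => [f cf qf] [g cg qg] /= fg.
by case: _ / fg in cg qg *; congr LhmHom.
Qed.

Lemma lhm_id_colinear (M : leftHopfModule) : left_colinear (lin_id M).
Proof. by move=> m; rewrite (tmap_id (lhm_coact M m)). Qed.

Lemma lhm_id_quasilinear (M : leftHopfModule) : left_quasilinear (lin_id M).
Proof. by []. Qed.

Definition lhm_id (M : leftHopfModule) : lhm_hom M M :=
  LhmHom (@lhm_id_colinear M) (@lhm_id_quasilinear M).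

Section Composition.
Variables (M N P : leftHopfModule) (f : lhm_hom N P) (g : lhm_hom M N).

Lemma lhm_comp_colinear : left_colinear (lin_comp f g).
Proof.
move=> m /=; rewrite (lhm_funC f) (lhm_funC g).
exact: (tmap_comp (lin_id H) (lin_id H) f g).
Qed.

Lemma lhm_comp_quasilinear : left_quasilinear (lin_comp f g).
Proof. by move=> h m /=; rewrite (lhm_funQ g) (lhm_funQ f). Qed.

Definition lhm_comp : lhm_hom M P :=
  LhmHom lhm_comp_colinear lhm_comp_quasilinear.

End Composition.

Lemma lhm_comp1f (M N : leftHopfModule) (f : lhm_hom M N) :
  lhm_comp (lhm_id N) f = f.
Proof. by apply: lhm_hom_ext; exact: lin_comp1f. Qed.

Lemma lhm_compf1 (M N : leftHopfModule) (f : lhm_hom M N) :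
  lhm_comp f (lhm_id M) = f.
Proof. by apply: lhm_hom_ext; exact: lin_compf1. Qed.

Lemma lhm_compA (M1 M2 M3 M4 : leftHopfModule) (f : lhm_hom M3 M4)
    (g : lhm_hom M2 M3) (h : lhm_hom M1 M2) :
  lhm_comp f (lhm_comp g h) = lhm_comp (lhm_comp f g) h.
Proof. by apply: lhm_hom_ext; exact: lin_compA. Qed.

Definition leftHopfModCat : category :=
  Category lhm_comp1f lhm_compf1 lhm_compA.

End LeftHopfModules.

(* Main.v *)
Require Import Defs.
From HB Require Import structures.
From mathcomp Require Import all_boot all_algebra.
From mathcomp Require Import boolp.

(* The right equivalence sends M to its coinvariants M^co = {n | ρ n = n ⊗ 1} and
   V to the free module V ⨂ H.  The projection E m = m_(0) · S m_(1) lands in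
   M^co, and n ⊗ h |-> n · h is an isomorphism M^co ⨂ H -> M with inverse
   m |-> E m_(0) ⊗ m_(1).  It is quasilinear, although the action is not
   associative, because the induced action of M sends (n · g, h) to n · (gh) for
   coinvariant n.

   Left Hopf modules over H are right Hopf modules over the opposite
   co-opposite Hopf quasigroup, which reduces the left case to the right one. *)

Set Implicit Arguments.
Unset Strict Implicit.
Unset Printing Implicit Defensive.

(* Defs is imported again because boolp and vector shadow its cid and hom. *)
Import GRing.Theory Defs.
Local Open Scope ring_scope.

(** * Multilinear maps and Sweedler notation *)

Section Multilinear.
Variable K : fieldType.
Implicit Types U V W X Y Z : lmodType K.

Lemma bilinearI V W U (F : V -> W -> U) :
  (forall w, linear (fun v => F v w)) -> (forall v, linear (fun w => F v w)) ->
  is_bilinear F.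
Proof. by move=> Fl Fr; split. Qed.

Definition is_trilinear U V W X (T : U -> V -> W -> X) : Prop :=
  [/\ forall v w, linear (fun u => T u v w),
      forall u w, linear (fun v => T u v w) &
      forall u v, linear (fun w => T u v w)].

Lemma linZ V W (f : V -> W) : linear f -> scalable f.
Proof. exact: scalable_linear. Qed.

Lemma tensZl V W a (v : V) (w : W) : (a *: v) ⊗ w = a *: (v ⊗ w).
Proof. exact: linZ (fst (tens_is_bilinear V W) w) a v. Qed.

Lemma tensZr V W a (v : V) (w : W) : v ⊗ (a *: w) = a *: (v ⊗ w).
Proof. exact: linZ (snd (tens_is_bilinear V W) v) a w. Qed.

Lemma lin_var V : linear (fun x : V => x).
Proof. by []. Qed.

Lemma lin_app V W X (f : {linear V -> W}) (g : X -> V) :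
  linear g -> linear (fun x => f (g x)).
Proof. by move=> gl a x y; rewrite gl linearP. Qed.

Lemma lin_tensl V W X (g : X -> V) (w : W) :
  linear g -> linear (fun x => g x ⊗ w).
Proof. by move=> gl a x y; rewrite gl tensPl. Qed.

Lemma lin_tensr V W X (v : V) (g : X -> W) :
  linear g -> linear (fun x => v ⊗ g x).
Proof. by move=> gl a x y; rewrite gl tensPr. Qed.

Lemma lin_scalel V W X (e : {scalar V}) (g : X -> V) (w : W) :
  linear g -> linear (fun x => e (g x) *: w).
Proof. by move=> gl a x y; rewrite gl linearP scalerDl scalerA. Qed.

Lemma lin_scaler V X (a : K) (g : X -> V) :
  linear g -> linear (fun x => a *: g x).
Proof. by move=> gl b x y; rewrite gl scalerDr !scalerA mulrC. Qed.

(** Since [t] stays fixed, the sum runs over one fixed decomposition and linearity in the parameter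
    holds term by term. The companion [lin_tliftt] treats a varying tensor, where bilinearity of the
    summand is what makes the decomposition irrelevant. *)
Lemma lin_tliftf V W X U (F : X -> V -> W -> U) (t : V ⨂ W) :
  (forall v w, linear (fun x => F x v w)) -> linear (fun x => tlift (F x) t).
Proof.
move=> Fl a x y; rewrite /tlift scaler_sumr -big_split.
by apply: eq_bigr => p _; apply: Fl.
Qed.

Lemma lin_tliftt V W X U (F : V -> W -> U) (t : X -> V ⨂ W) :
  is_bilinear F -> linear t -> linear (fun x => tlift F (t x)).
Proof. by move=> bF tl a x y; rewrite tl tlift_is_linear. Qed.

End Multilinear.

(** Discharges the multilinearity side conditions of the Sweedler calculus by following the shape of
    the expression. Hypotheses are tried first and application of a bundled linear map last. *)
Ltac multilin :=
  lazymatch goal with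
  | |- is_trilinear _ => split=> ? ?; multilin
  | |- is_bilinear _ => apply: bilinearI => ?; multilin
  | |- forall _, _ => move=> ?; multilin
  | |- _ => first
    [ match goal with h : _ |- _ => solve [exact: h | apply: h] end
    | exact: lin_var
    | apply: lin_tensl; multilin
    | apply: lin_tensr; multilin
    | apply: lin_scalel; multilin
    | apply: lin_scaler; multilin
    | apply: lin_tliftf; multilin
    | apply: lin_tliftt; multilin
    | apply: lin_app; multilin ]
  end.

(** * Rewriting rules for Sweedler sums *)

Section Sweedler.
Variable K : fieldType.
Implicit Types U V W X Y Z : lmodType K.

Lemma eq_tlift V W U (F G : V -> W -> U) t :
  (forall v w, F v w = G v w) -> tlift F t = tlift G t.
Proof. by move=> FG; apply: eq_bigr => p _; apply: FG. Qed.

Lemma linear_tlift V W U X (f : {linear U -> X}) (F : V -> W -> U) t :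
  f (tlift F t) = \sw_(v, w <- t) f (F v w).
Proof. exact: linear_sum. Qed.

(* Unlike linear_tlift, this applies to maps without a bundled linear
   structure, with f given explicitly. *)
Lemma lin_tlift V W U X (f : U -> X) (F : V -> W -> U) t :
  linear f -> f (tlift F t) = \sw_(v, w <- t) f (F v w).
Proof.
move=> fl; pose g := GRing.isLinear.Build K U X *:%R f fl.
pose f' : {linear U -> X} := HB.pack f g.
exact: (linear_tlift f').
Qed.

(** Removes a nested decomposition: once a tensor has been computed as a Sweedler sum, bilinearity
    of [F] lets its explicit terms replace those of the chosen representative. *)
Lemma tlift_tlift V W V' W' U (F : V -> W -> U) (G : V' -> W' -> V)
    (L : V' -> W' -> W) t : is_bilinear F ->
  tlift F (\sw_(v, w <- t) (G v w ⊗ L v w)) = \sw_(v, w <- t) F (G v w) (L v w).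
Proof.
move=> bF; rewrite (lin_tlift _ _ (tlift_is_linear bF)).
by apply: eq_tlift => v w; rewrite tlift_tens.
Qed.

Lemma exchange_tlift V W V' W' U (F : V -> W -> V' -> W' -> U) t t' :
  \sw_(v, w <- t) \sw_(v', w' <- t') F v w v' w' =
  \sw_(v', w' <- t') \sw_(v, w <- t) F v w v' w'.
Proof. exact: exchange_big. Qed.

Lemma tens_expand V W (t : V ⨂ W) : t = \sw_(v, w <- t) (v ⊗ w).
Proof. exact: tensE. Qed.

(** A form of [tensor_ext] for maps without a bundled linear structure, such as the two sides of a
    Sweedler identity; [multilin] supplies the linearity premises. *)
Lemma tens_ext V W U (f g : V ⨂ W -> U) : linear f -> linear g ->
  (forall v w, f (v ⊗ w) = g (v ⊗ w)) -> f =1 g.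
Proof.
by move=> fl gl fg t; rewrite (tens_expand t) !lin_tlift //; apply: eq_tlift.
Qed.

Lemma tlift_tmap V W V' W' U (F : V' -> W' -> U) (f : {linear V -> V'})
    (g : {linear W -> W'}) t : is_bilinear F ->
  tlift F (tmap f g t) = \sw_(v, w <- t) F (f v) (g w).
Proof. exact: tlift_tlift. Qed.

Lemma tlift_assoc U V W X (T : U -> V -> W -> X) t : is_trilinear T ->
  \sw_(u, y <- tassoc t) \sw_(v, w <- y) T u v w =
  \sw_(x, w <- t) \sw_(u, v <- x) T u v w.
Proof.
move=> [T1 T2 T3]; rewrite /tassoc.
rewrite (lin_tlift _ (f := fun t => \sw_(u, y <- t) \sw_(v, w <- y) T u v w)); last first.
  by multilin.
apply: eq_tlift => x w.
rewrite (lin_tlift _ (f := fun t => \sw_(u, y <- t) \sw_(v, w <- y) T u v w)); last first.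
  by multilin.
apply: eq_tlift => u v; rewrite !tlift_tens //; multilin.
Qed.

(** Turns coassociativity into a rule that regroups Sweedler indices inside any trilinear
    expression. Keeping [f] and [g] independent makes it serve coproducts, right coactions and left
    coactions alike. *)
Lemma coassoc_sweedler U V W X Y Z (f : {linear Y -> U ⨂ V})
    (g : {linear Z -> V ⨂ W}) (t : Y ⨂ W) (t' : U ⨂ Z) :
  tassoc (tmap f idfun t) = tmap idfun g t' ->
  forall T : U -> V -> W -> X, is_trilinear T ->
  \sw_(x, w <- t) \sw_(u, v <- f x) T u v w =
  \sw_(u, y <- t') \sw_(v, w <- g y) T u v w.
Proof.
move=> e T [T1 T2 T3].
have := congr1 (fun s => \sw_(u, y <- s) \sw_(v, w <- y) T u v w) e.
rewrite tlift_assoc // tlift_tmap; last by multilin.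
by rewrite tlift_tmap //; multilin.
Qed.

(** Converse of [coassoc_sweedler]: the single trilinear map [u ⊗ (v ⊗ w)] is universal, so testing
    on it is enough. *)
Lemma sweedler_coassoc U V W Y Z (f : {linear Y -> U ⨂ V})
    (g : {linear Z -> V ⨂ W}) (t : Y ⨂ W) (t' : U ⨂ Z) :
  \sw_(x, w <- t) \sw_(u, v <- f x) (u ⊗ (v ⊗ w)) =
  \sw_(u, y <- t') \sw_(v, w <- g y) (u ⊗ (v ⊗ w)) ->
  tassoc (tmap f idfun t) = tmap idfun g t'.
Proof.
move=> e; rewrite /tassoc tlift_tmap; last by multilin.
rewrite e; apply: eq_tlift => u y /=; rewrite [in RHS](tens_expand (g y)).
by rewrite (lin_tlift (f := tens u)) //; multilin.
Qed.

End Sweedler.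

(** * Right Hopf modules *)

Section RightModules.
Variables (K : fieldType) (H : hopfQuasigroup K).

Local Notation "x ** y" := (hq_mul H (x ⊗ y)) (at level 40).
Local Notation Δ := (hq_comul H).
Local Notation ε := (hq_counit H).
Local Notation S := (hq_antipode H).
Local Notation ρ := (rhm_coact _).
Local Notation "m ∙ h" := (rhm_act _ (m ⊗ h)) (at level 39, left associativity).

Lemma hq_coassoc_sw (X : lmodType K) (T : H -> H -> H -> X) h :
  is_trilinear T ->
  \sw_(x, h3 <- Δ h) \sw_(h1, h2 <- Δ x) T h1 h2 h3 =
  \sw_(h1, y <- Δ h) \sw_(h2, h3 <- Δ y) T h1 h2 h3.
Proof. exact: coassoc_sweedler (hq_coassoc h) _. Qed.

(** * The projection onto coinvariants and the induced action *)

Section Module.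
Variable M : rightHopfModule H.
Implicit Types (m n : M) (g h : H).

Lemma rhm_coassoc_sw (X : lmodType K) (T : M -> H -> H -> X) m :
  is_trilinear T ->
  \sw_(x, h2 <- ρ m) \sw_(m0, h1 <- ρ x) T m0 h1 h2 =
  \sw_(m0, y <- ρ m) \sw_(h1, h2 <- Δ y) T m0 h1 h2.
Proof. exact: coassoc_sweedler (rhm_coassoc m) _. Qed.

Definition rhm_proj m : M := \sw_(m0, m1 <- ρ m) (m0 ∙ S m1).

Lemma rhm_proj_is_linear : linear rhm_proj.
Proof. by rewrite /rhm_proj; multilin. Qed.

HB.instance Definition _ :=
  GRing.isLinear.Build K M M *:%R rhm_proj rhm_proj_is_linear.

(** Coassociativity makes [S m_(1)] and [m_(2)] the two halves of one coproduct, which [rhm_actVK]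
    collapses to a counit. *)
Lemma rhm_projK m : \sw_(m0, m1 <- ρ m) (rhm_proj m0 ∙ m1) = m.
Proof.
rewrite -[RHS]rhm_counit /rhm_proj.
under eq_tlift => x h2.
  rewrite (lin_tlift (f := fun z => z ∙ h2)); last by multilin.
  over.
rewrite rhm_coassoc_sw; last by multilin.
by under eq_tlift => m0 y do rewrite rhm_actVK.
Qed.

(** The diagonal action of [H] on [M ⨂ H]: the Hopf module axiom [rhm_coactM] says that the coaction
    intertwines the action of [M] with this one. *)
Definition diag_act (t : M ⨂ H) h : M ⨂ H :=
  \sw_(x, g <- t) \sw_(h1, h2 <- Δ h) ((x ∙ h1) ⊗ (g ** h2)).

(* Cancels diag_act: S h1 acts first, on the H component, where it meets the h2
   of diag_act; only then are the factors on M adjacent.  Cancelling this way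
   gives rhm_proj_coinv without proving that S is anti-comultiplicative. *)
Definition diag_cancel (t : M ⨂ H) h : M ⨂ H :=
  \sw_(x, g <- t) \sw_(h1, h2 <- Δ h) ((x ∙ S h2) ⊗ (g ** S h1)).

Lemma diag_act_bilinear : is_bilinear diag_act.
Proof. by rewrite /diag_act; multilin. Qed.

Lemma diag_cancel_bilinear : is_bilinear diag_cancel.
Proof. by rewrite /diag_cancel; multilin. Qed.

Lemma diag_actK t h : \sw_(h1, h2 <- Δ h) diag_cancel (diag_act t h1) h2 = ε h *: t.
Proof.
have [cl cr] := diag_cancel_bilinear; have [al ar] := diag_act_bilinear.
rewrite {1}(tens_expand t).
under eq_tlift => h1 h2.
  rewrite (lin_tlift (f := fun z => diag_cancel (diag_act z h1) h2)); last first.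
    by move=> a x y; rewrite al cl.
  over.
rewrite exchange_tlift [in RHS](tens_expand t) linear_tlift.
apply: eq_tlift => x g.
under eq_tlift => h1 h2.
  rewrite /diag_act tlift_tens; last by multilin.
  rewrite (lin_tlift (f := fun z => diag_cancel z h2)) //.
  under eq_tlift => a b.
    rewrite /diag_cancel tlift_tens; last by multilin.
    over.
  over.
(* With [a, b, c, d] the four legs of the iterated coproduct of [h], the summand is
   [(x ∙ a ∙ S d) ⊗ ((g ** b) ** S c)]. Regrouping isolates the middle pair [b, c], which collapses
   by [hq_antipodeKr]; the outer pair [a, d] then becomes adjacent and collapses by [rhm_actK]. *)
rewrite hq_coassoc_sw; last by multilin.
under eq_tlift => a y.
  rewrite -hq_coassoc_sw; last by multilin.
  under eq_tlift => w d.
    rewrite -(lin_tlift (f := fun z => (x ∙ a ∙ S d) ⊗ z)); last by multilin.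
    rewrite hq_antipodeKr tensZr.
    rewrite -(linZ (f := fun z => (x ∙ a ∙ S z) ⊗ g)); last by multilin.
    over.
  rewrite -(lin_tlift (f := fun z => (x ∙ a ∙ S z) ⊗ g)); last by multilin.
  rewrite hq_counitl.
  over.
rewrite -(lin_tlift (f := fun z => z ⊗ g)); last by multilin.
by rewrite rhm_actK tensZl.
Qed.

(** By [diag_actK], a linear map [M -> M ⨂ H] can be recovered from its convolution with [diag_act]
    along the coaction. An identity between such maps may therefore be checked after letting [m_(1)]
    act. *)
Lemma diag_act_inj (X Y : M -> M ⨂ H) : linear X -> linear Y ->
  (forall m, \sw_(m0, m1 <- ρ m) diag_act (X m0) m1 =
             \sw_(m0, m1 <- ρ m) diag_act (Y m0) m1) -> X =1 Y.
Proof.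
have [cl cr] := diag_cancel_bilinear; have [al ar] := diag_act_bilinear.
have recover Z : linear Z -> forall m, Z m =
    \sw_(x, h <- ρ m) diag_cancel (\sw_(m0, m1 <- ρ x) diag_act (Z m0) m1) h.
  (* The counit axiom inserts a scalar [ε m_(1)], which is then traded for [diag_act] followed by
     [diag_cancel] along the coproduct of [m_(1)]. *)
  move=> Zl m; rewrite -{1}[m]rhm_counit lin_tlift //.
  under eq_tlift => m0 y do rewrite linZ // -diag_actK.
  rewrite -rhm_coassoc_sw; last first.
    split=> ? ? a x y; first by rewrite Zl al cl.
      by rewrite ar cl.
    by rewrite cr.
  apply: eq_tlift => x h.
  by rewrite (lin_tlift (f := fun z => diag_cancel z h)).
move=> Xl Yl XY m; rewrite recover // [RHS]recover //.
by apply: eq_tlift => x h; rewrite XY.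
Qed.

(** After the diagonal action of [m_(1)] both sides become [ρ m]: the left one because it is the
    coaction of the sum in [rhm_projK], the right one by coassociativity and [rhm_projK] on the
    first leg. [diag_act_inj] then concludes. *)
Lemma rhm_proj_coinv m : ρ (rhm_proj m) = rhm_proj m ⊗ hq_one H.
Proof.
apply: (diag_act_inj (X := fun m => ρ (rhm_proj m))
  (Y := fun m => rhm_proj m ⊗ hq_one H)) => [||{}m]; try by multilin.
under eq_tlift => m0 m1 do rewrite /diag_act -rhm_coactM.
rewrite -(linear_tlift ρ) rhm_projK.
under [RHS]eq_tlift => m0 m1.
  rewrite /diag_act tlift_tens; last by multilin.
  under eq_tlift => h1 h2 do rewrite hq_mul1h.
  over.
rewrite -rhm_coassoc_sw; last by multilin.
rewrite [LHS]tens_expand; apply: eq_tlift => x h.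
by rewrite -{1}[x]rhm_projK (lin_tlift (f := fun z => z ⊗ h)) //; multilin.
Qed.

Lemma coact_coinvM n h : ρ n = n ⊗ hq_one H ->
  ρ (n ∙ h) = \sw_(h1, h2 <- Δ h) ((n ∙ h1) ⊗ h2).
Proof.
move=> cn; rewrite rhm_coactM cn tlift_tens; last by multilin.
by apply: eq_tlift => h1 h2; rewrite hq_mul1h.
Qed.

Lemma rhm_proj_coinvM n h : ρ n = n ⊗ hq_one H -> rhm_proj (n ∙ h) = ε h *: n.
Proof.
move=> cn; rewrite /rhm_proj coact_coinvM // tlift_tlift ?rhm_actK //.
by multilin.
Qed.

(** Coassociativity groups [m_(0)] and [S m_(1)] into the projection. In this form the induced
    action is right multiplication on the [H] factor, carried over from coinvariants tensored with
    [H]. *)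
Lemma rhm_inducedE m h :
  rhm_induced m h = \sw_(m0, m1 <- ρ m) (rhm_proj m0 ∙ (m1 ** h)).
Proof.
rewrite /rhm_induced tlift_tmap; last by multilin.
rewrite /= -rhm_coassoc_sw; last by multilin.
apply: eq_tlift => x h2.
by rewrite -(lin_tlift (f := fun z => z ∙ (h2 ** h))) //; multilin.
Qed.

Lemma rhm_induced_coinvM n g h : ρ n = n ⊗ hq_one H ->
  rhm_induced (n ∙ g) h = n ∙ (g ** h).
Proof.
move=> cn; rewrite rhm_inducedE coact_coinvM // tlift_tlift; last by multilin.
under eq_tlift => g1 g2.
  rewrite rhm_proj_coinvM //.
  rewrite tensZl linearZ_LR -(linZ (f := fun z => n ∙ (z ** h))); last by multilin.
  over.
by rewrite -(lin_tlift (f := fun z => n ∙ (z ** h))) ?hq_counitl //; multilin.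
Qed.

Lemma rhm_induced_coinv n h : ρ n = n ⊗ hq_one H -> rhm_induced n h = n ∙ h.
Proof. by move=> cn; rewrite -{1}[n]rhm_act1 rhm_induced_coinvM ?hq_mul1h. Qed.

End Module.

(** * The free right Hopf module on a vector space *)

Section FreeModule.
Variable V : lmodType K.

Definition free_coact (t : V ⨂ H) : (V ⨂ H) ⨂ H :=
  \sw_(v, h <- t) \sw_(h1, h2 <- Δ h) ((v ⊗ h1) ⊗ h2).

Definition free_act (x : (V ⨂ H) ⨂ H) : V ⨂ H :=
  \sw_(t, g <- x) \sw_(v, h <- t) (v ⊗ (h ** g)).

Lemma free_coact_is_linear : linear free_coact.
Proof. by rewrite /free_coact; multilin. Qed.

Lemma free_act_is_linear : linear free_act.
Proof. by rewrite /free_act; multilin. Qed.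

HB.instance Definition _ :=
  GRing.isLinear.Build K (V ⨂ H) ((V ⨂ H) ⨂ H) *:%R free_coact free_coact_is_linear.
HB.instance Definition _ :=
  GRing.isLinear.Build K ((V ⨂ H) ⨂ H) (V ⨂ H) *:%R free_act free_act_is_linear.

Lemma free_coact_tens v h :
  free_coact (v ⊗ h) = \sw_(h1, h2 <- Δ h) ((v ⊗ h1) ⊗ h2).
Proof. by rewrite /free_coact tlift_tens //; multilin. Qed.

Lemma free_act_tens v h g : free_act ((v ⊗ h) ⊗ g) = v ⊗ (h ** g).
Proof. by rewrite /free_act !tlift_tens //; multilin. Qed.

Lemma free_coassoc t :
  tassoc (tmap free_coact idfun (free_coact t)) =
  tmap idfun Δ (free_coact t).
Proof.
apply: sweedler_coassoc.
move: t; apply: tens_ext => [||v h /=]; try by multilin.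
rewrite free_coact_tens !tlift_tlift; try by multilin.
under eq_tlift => x h3.
  rewrite /= free_coact_tens tlift_tlift; last by multilin.
  over.
by rewrite hq_coassoc_sw //; multilin.
Qed.

Lemma free_counit t :
  \sw_(t0, h <- free_coact t) (ε h *: t0) = t.
Proof.
move: t; apply: tens_ext => [||v h /=]; try by multilin.
rewrite free_coact_tens !tlift_tlift; try by multilin.
under eq_tlift => h1 h2 do rewrite -tensZr.
by rewrite -(lin_tlift (f := fun z => v ⊗ z)) ?hq_counitr //; multilin.
Qed.

Lemma free_act1 t : free_act (t ⊗ hq_one H) = t.
Proof.
move: t; apply: tens_ext => [||v h /=]; try by multilin.
by rewrite free_act_tens hq_mulh1.
Qed.

Lemma free_actK t h :
  \sw_(h1, h2 <- Δ h) free_act (free_act (t ⊗ h1) ⊗ S h2) = ε h *: t.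
Proof.
move: t; apply: tens_ext => [||v g /=]; try by multilin.
under eq_tlift => h1 h2 do rewrite !free_act_tens.
rewrite -(lin_tlift (f := fun z => v ⊗ z)); last by multilin.
by rewrite hq_antipodeKr tensZr.
Qed.

Lemma free_actVK t h :
  \sw_(h1, h2 <- Δ h) free_act (free_act (t ⊗ S h1) ⊗ h2) = ε h *: t.
Proof.
move: t; apply: tens_ext => [||v g /=]; try by multilin.
under eq_tlift => h1 h2 do rewrite !free_act_tens.
rewrite -(lin_tlift (f := fun z => v ⊗ z)); last by multilin.
by rewrite hq_antipodeVKr tensZr.
Qed.

Lemma free_coactM t h :
  free_coact (free_act (t ⊗ h)) =
  \sw_(t0, g <- free_coact t) \sw_(h1, h2 <- Δ h)
    (free_act (t0 ⊗ h1) ⊗ (g ** h2)).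
Proof.
move: t; apply: tens_ext => [||v g /=]; try by multilin.
rewrite free_act_tens !free_coact_tens hq_comulM !tlift_tlift; try by multilin.
rewrite (lin_tlift (f := fun z => \sw_(h1, h2 <- z) ((v ⊗ h1) ⊗ h2))); last first.
  by multilin.
apply: eq_tlift => g1 g2; rewrite tlift_tlift; last by multilin.
by apply: eq_tlift => h1 h2; rewrite free_act_tens.
Qed.

Definition free_rhm : rightHopfModule H :=
  RightHopfModule free_coassoc free_counit free_act1 free_actK free_actVK
    free_coactM.

Lemma free_coinv v : rhm_coact free_rhm (v ⊗ hq_one H) = (v ⊗ hq_one H) ⊗ hq_one H.
Proof. by rewrite /= free_coact_tens hq_comul1 tlift_tens //; multilin. Qed.

(** Here [v ⊗ g] is the coinvariant [v ⊗ 1] acted on by [g], so [rhm_induced_coinvM] applies. On a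
    free module the induced action is thus the action itself. *)
Lemma free_induced v g h :
  rhm_induced (M := free_rhm) (v ⊗ g) h = v ⊗ (g ** h).
Proof.
have := rhm_induced_coinvM g h (free_coinv v).
by rewrite /= !free_act_tens !hq_mul1h.
Qed.

End FreeModule.

End RightModules.

(** * The equivalence for right Hopf modules *)

Section Coinvariants.
Variables (K : fieldType) (H : hopfQuasigroup K) (M : rightHopfModule H).

(** Coinvariance is an equation in a tensor product; its classical boolean reflection gives access
    to the submodule and subtype structures. *)
Definition coinv_pred : {pred M} :=
  fun m => `[< rhm_coact M m = m ⊗ hq_one H >].

Lemma coinv_submod_closed : submod_closed coinv_pred.
Proof.
split=> [|a x y /asboolP cx /asboolP cy]; apply/asboolP.
  (* Writing the left factor as [0 *: 0] lets the zero scalar move out of the tensor. *)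
  by rewrite linear0 -[X in X ⊗ _](scale0r 0) tensZl scale0r.
by rewrite linearP cx cy tensPl.
Qed.

HB.instance Definition _ :=
  GRing.isSubmodClosed.Build K M coinv_pred coinv_submod_closed.

Record coinv := Coinv { coinv_val : M; coinv_valP : coinv_val \in coinv_pred }.

HB.instance Definition _ := [isSub for coinv_val].
HB.instance Definition _ := [Choice of coinv by <:].
HB.instance Definition _ := [SubChoice_isSubLmodule of coinv by <:].

Lemma coinv_val_is_linear : linear coinv_val.
Proof. exact: (linearP (val : coinv -> M)). Qed.

HB.instance Definition _ :=
  GRing.isLinear.Build K coinv M *:%R coinv_val coinv_val_is_linear.

Lemma coinvE (n : coinv) : rhm_coact M (coinv_val n) = coinv_val n ⊗ hq_one H.
Proof. exact/asboolP/coinv_valP. Qed.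

Lemma coinv_val_inj : injective coinv_val.
Proof. exact: val_inj. Qed.

End Coinvariants.

Section RightEquivalence.
Variables (K : fieldType) (H : hopfQuasigroup K).

(** * The functor of coinvariants *)

Section CoinvMap.
Variables (M N : rightHopfModule H) (f : rhm_hom M N).

Lemma coinv_map_subproof (n : coinv M) : f (coinv_val n) \in coinv_pred (M := N).
Proof. by apply/asboolP; rewrite rhm_funC coinvE tmap_tens. Qed.

Definition coinv_map_fun (n : coinv M) : coinv N := Coinv (coinv_map_subproof n).

Lemma coinv_map_is_linear : linear coinv_map_fun.
Proof. by move=> a x y; apply: coinv_val_inj; rewrite !linearP /= linearP. Qed.

HB.instance Definition _ := GRing.isLinear.Build K (coinv M) (coinv N) *:%R
  coinv_map_fun coinv_map_is_linear.

Definition coinv_map : {linear coinv M -> coinv N} := coinv_map_fun.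

End CoinvMap.

Definition coinv_obj (M : rightHopfModCat H) : vectCat K := coinv (M : rightHopfModule H).

Lemma coinv_map1 (M : rightHopfModCat H) :
  coinv_map (cid M : rhm_hom _ _) = cid (coinv_obj M).
Proof. by apply: linear_map_ext => x; apply: coinv_val_inj. Qed.

Lemma coinv_mapM (M N P : rightHopfModCat H) (f : hom N P) (g : hom M N) :
  coinv_map (ccomp f g : rhm_hom _ _) =
  ccomp (coinv_map f : hom (coinv_obj N) (coinv_obj P))
        (coinv_map g : hom (coinv_obj M) (coinv_obj N)).
Proof. by apply: linear_map_ext => x; apply: coinv_val_inj. Qed.

Definition coinv_functor : functor (rightHopfModCat H) (vectCat K) :=
  @Functor _ _ coinv_obj (fun M N f => coinv_map f) coinv_map1 coinv_mapM.

(** * The free module functor *)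

Section FreeMap.
Variables (V W : lmodType K) (f : {linear V -> W}).

Definition free_map_lin : {linear free_rhm H V -> free_rhm H W} :=
  tmap f (lin_id H).

Lemma free_map_tens v h : free_map_lin (v ⊗ h) = f v ⊗ h.
Proof. exact: tmap_tens. Qed.

Lemma free_map_colinear : right_colinear free_map_lin.
Proof.
apply: tens_ext => [||v h]; try by multilin.
rewrite free_map_tens /= !free_coact_tens (linear_tlift (tmap _ _)).
by apply: eq_tlift => h1 h2; rewrite /= tmap_tens free_map_tens.
Qed.

Lemma free_map_quasilinear : right_quasilinear free_map_lin.
Proof.
move=> t h; move: t; apply: tens_ext => [||v g]; try by rewrite /rhm_induced; multilin.
by rewrite free_induced !free_map_tens free_induced.
Qed.

Definition free_map : rhm_hom (free_rhm H V) (free_rhm H W) :=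
  RhmHom free_map_colinear free_map_quasilinear.

End FreeMap.

Definition free_obj (V : vectCat K) : rightHopfModCat H := free_rhm H V.

Lemma free_map1 (V : vectCat K) :
  free_map (cid V) = cid (free_obj V).
Proof. by apply/rhm_hom_ext/linear_map_ext => t; apply: tmap_id. Qed.

Lemma free_mapM (U V W : vectCat K) (f : hom V W) (g : hom U V) :
  free_map (ccomp f g) =
  ccomp (free_map f : hom (free_obj V) (free_obj W))
        (free_map g : hom (free_obj U) (free_obj V)).
Proof.
by apply/rhm_hom_ext/linear_map_ext => t; rewrite [RHS]tmap_comp.
Qed.

Definition free_functor : functor (vectCat K) (rightHopfModCat H) :=
  @Functor _ _ free_obj (fun V W f => free_map f)
    free_map1 free_mapM.

(** A morphism commutes with the induced action, which agrees with the action itself on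
    coinvariants; colinearity keeps [f (coinv_val n)] coinvariant. This is the source of the
    naturality of [unfree]. *)
Lemma rhm_hom_coinvM (M N : rightHopfModule H) (f : rhm_hom M N) (n : coinv M) h :
  f (rhm_act M (coinv_val n ⊗ h)) = rhm_act N (f (coinv_val n) ⊗ h).
Proof.
rewrite -rhm_induced_coinv; last exact: coinvE.
by rewrite rhm_funQ rhm_induced_coinv //; apply: coinvE (coinv_map f n).
Qed.

(** Together with [inverse_quasilinear], this lets [refree] inherit both morphism conditions from
    [unfree], whose values on pure tensors are explicit. *)
Lemma inverse_colinear (M N : rightHopfModule H) (f : {linear M -> N})
    (g : {linear N -> M}) :
  cancel f g -> cancel g f -> right_colinear f -> right_colinear g.
Proof.
move=> fK gK fC n; rewrite -[in RHS](gK n) fC tmap_comp.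
rewrite [LHS]tens_expand; apply: eq_tlift => m h /=.
by rewrite fK.
Qed.

Lemma inverse_quasilinear (M N : rightHopfModule H) (f : {linear M -> N})
    (g : {linear N -> M}) :
  cancel f g -> cancel g f -> right_quasilinear f -> right_quasilinear g.
Proof. by move=> fK gK fQ n h; rewrite -{1}(gK n) -fQ fK. Qed.

(** * Every right Hopf module is free on its coinvariants *)

Section CoinvCounit.
Variable M : rightHopfModule H.

Definition unfree_fun (t : coinv M ⨂ H) : M :=
  \sw_(n, h <- t) rhm_act M (coinv_val n ⊗ h).

Lemma unfree_is_linear : linear unfree_fun.
Proof. by rewrite /unfree_fun; multilin. Qed.

HB.instance Definition _ :=
  GRing.isLinear.Build K (coinv M ⨂ H) M *:%R unfree_fun unfree_is_linear.

Definition unfree_lin : {linear free_rhm H (coinv M) -> M} := unfree_fun.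

Lemma unfree_tens n h : unfree_fun (n ⊗ h) = rhm_act M (coinv_val n ⊗ h).
Proof. by rewrite /unfree_fun tlift_tens //; multilin. Qed.

Definition coinv_proj (m : M) : coinv M :=
  Coinv (introT (asboolP _) (rhm_proj_coinv m)).

Lemma coinv_proj_is_linear : linear coinv_proj.
Proof. by move=> a x y; apply: coinv_val_inj; rewrite !linearP /= linearP. Qed.

HB.instance Definition _ :=
  GRing.isLinear.Build K M (coinv M) *:%R coinv_proj coinv_proj_is_linear.

Definition refree_lin : {linear M -> free_rhm H (coinv M)} :=
  tmap coinv_proj (lin_id H) \o rhm_coact M.

Lemma refreeK : cancel refree_lin unfree_lin.
Proof.
move=> m; rewrite /= /unfree_fun tlift_tmap; last by multilin.
exact: rhm_projK.
Qed.

(** For coinvariant [n], the element [n · h] is sent to the sum of the [E (n · h1) ⊗ h2]. Each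
    [E (n · h1)] equals [ε h1 *: n], and the counit axiom restores [n ⊗ h]. *)
Lemma unfreeK : cancel unfree_lin refree_lin.
Proof.
apply: tens_ext => [||n h /=]; try by multilin.
rewrite unfree_tens coact_coinvM; last exact: coinvE.
rewrite (linear_tlift (tmap _ _)).
under eq_tlift => h1 h2.
  rewrite /= tmap_tens /= (_ : coinv_proj _ = hq_counit H h1 *: n); last first.
    by apply: coinv_val_inj; rewrite linearZ /= rhm_proj_coinvM //; exact: coinvE.
  rewrite tensZl -tensZr.
  over.
by rewrite -(lin_tlift (f := fun z => n ⊗ z)) ?hq_counitl //; multilin.
Qed.

Lemma unfree_colinear : right_colinear unfree_lin.
Proof.
apply: tens_ext => [||n h /=]; try by multilin.
rewrite unfree_tens coact_coinvM; last exact: coinvE.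
rewrite free_coact_tens (linear_tlift (tmap _ _)).
by apply: eq_tlift => h1 h2; rewrite /= tmap_tens /= unfree_tens.
Qed.

Lemma unfree_quasilinear : right_quasilinear unfree_lin.
Proof.
move=> t h; move: t; apply: tens_ext => [||n g]; try by rewrite /rhm_induced; multilin.
by rewrite free_induced /= !unfree_tens rhm_induced_coinvM //; exact: coinvE.
Qed.

Definition unfree : rhm_hom (free_rhm H (coinv M)) M :=
  RhmHom unfree_colinear unfree_quasilinear.

Definition refree : rhm_hom M (free_rhm H (coinv M)) :=
  RhmHom (inverse_colinear unfreeK refreeK unfree_colinear)
         (inverse_quasilinear unfreeK refreeK unfree_quasilinear).

End CoinvCounit.

(** * The coinvariants of a free module recover the vector space *)

Section FreeCoinv.
Variable V : lmodType K.

Definition free_eps_fun (t : coinv (free_rhm H V)) : V :=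
  \sw_(v, h <- coinv_val t) (hq_counit H h *: v).

Lemma free_eps_is_linear : linear free_eps_fun.
Proof.
move=> a x y; rewrite /free_eps_fun linearP.
by apply: (tlift_is_linear (F := fun v h => hq_counit H h *: v)); multilin.
Qed.

HB.instance Definition _ := GRing.isLinear.Build K (coinv (free_rhm H V)) V *:%R
  free_eps_fun free_eps_is_linear.

Definition free_eps : {linear coinv (free_rhm H V) -> V} := free_eps_fun.

Definition free_eta_fun (v : V) : coinv (free_rhm H V) :=
  Coinv (introT (asboolP _) (free_coinv H v)).

Lemma free_eta_is_linear : linear free_eta_fun.
Proof. by move=> a x y; apply: coinv_val_inj; rewrite linearP /= tensPl. Qed.

HB.instance Definition _ := GRing.isLinear.Build K V (coinv (free_rhm H V)) *:%R
  free_eta_fun free_eta_is_linear.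

Definition free_eta : {linear V -> coinv (free_rhm H V)} := free_eta_fun.

Lemma free_etaK : cancel free_eta free_eps.
Proof.
move=> v; rewrite /= /free_eps_fun /= tlift_tens; last by multilin.
by rewrite hq_counit1 scale1r.
Qed.

Lemma free_epsK : cancel free_eps free_eta.
Proof.
move=> n; apply: coinv_val_inj => /=.
(* This is [ε] applied to the middle factor of [V ⨂ H ⨂ H], a left inverse of the coaction by the
   counit axiom. Applied to [ρ t = t ⊗ 1], it shows that a coinvariant [t] is [free_eps t ⊗ 1]. *)
pose contract (s : (V ⨂ H) ⨂ H) : V ⨂ H :=
  \sw_(t, g <- s) (\sw_(v, h <- t) (hq_counit H h *: v) ⊗ g).
have contractK t : contract (free_coact t) = t.
  move: t; apply: tens_ext => [||v h]; try by rewrite /contract; multilin.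
  rewrite free_coact_tens /contract tlift_tlift; last by multilin.
  under eq_tlift => h1 h2.
    rewrite tlift_tens; last by multilin.
    rewrite tensZl -tensZr.
    over.
  by rewrite -(lin_tlift (f := fun z => v ⊗ z)) ?hq_counitl //; multilin.
rewrite -[RHS]contractK [free_coact _](coinvE n) /contract tlift_tens //.
by multilin.
Qed.

End FreeCoinv.

Lemma unfree_natural (M N : rightHopfModCat H) (f : hom M N) :
  ccomp (fmap (functor_id (rightHopfModCat H)) f)
    (unfree M : hom (functor_comp free_functor coinv_functor M) M) =
  ccomp (unfree N : hom (functor_comp free_functor coinv_functor N) N)
    (fmap (functor_comp free_functor coinv_functor) f).
Proof.
apply/rhm_hom_ext/linear_map_ext; apply: tens_ext => [||n h /=]; try by multilin.
by rewrite tmap_tens !unfree_tens rhm_hom_coinvM.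
Qed.

Lemma free_eps_natural (V W : vectCat K) (f : hom V W) :
  ccomp (fmap (functor_id (vectCat K)) f)
    (free_eps V : hom (functor_comp coinv_functor free_functor V) V) =
  ccomp (free_eps W : hom (functor_comp coinv_functor free_functor W) W)
    (fmap (functor_comp coinv_functor free_functor) f).
Proof.
apply: linear_map_ext => n /=; rewrite /free_eps_fun /= tlift_tmap; last by multilin.
by rewrite linear_tlift; apply: eq_tlift => v h; rewrite linearZ.
Qed.

Lemma right_equivalence :
  equivalent_categories (rightHopfModCat H) (vectCat K).
Proof.
exists coinv_functor, free_functor; split; constructor.
- refine (@NatIso _ _ (functor_comp free_functor coinv_functor) (functor_id _)
    (fun M => unfree M) (fun M => refree M) unfree_natural _ _).
    by move=> M; apply/rhm_hom_ext/linear_map_ext/unfreeK.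
  by move=> M; apply/rhm_hom_ext/linear_map_ext/refreeK.
refine (@NatIso _ _ (functor_comp coinv_functor free_functor) (functor_id _)
  (fun V => free_eps V) (fun V => free_eta V) free_eps_natural _ _).
  by move=> V; apply/linear_map_ext/free_epsK.
by move=> V; apply/linear_map_ext/free_etaK.
Qed.

End RightEquivalence.

(** * Left Hopf modules through the opposite co-opposite *)

Section EquivalenceTrans.
Variables C D E : category.

(** On [C] the round trip is undone from inside: [fmap G] of [i'] at [F a], then [i] at [a]. The
    round trip on [E] is symmetric. [fmapK] transports inverse pairs through a functor and [midK]
    cancels the adjacent middle arrows. *)
Lemma equivalent_categories_trans :
  equivalent_categories C D -> equivalent_categories D E ->
  equivalent_categories C E.
Proof.
move=> [F [G [[i] [j]]]] [F' [G' [[i'] [j']]]].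
have fmapK (A B : category) (T : functor A B) (x y : A)
    (f : hom x y) (g : hom y x) :
    ccomp f g = cid y -> ccomp (fmap T f) (fmap T g) = cid (T y).
  by move=> e; rewrite -fmapM e fmap1.
have midK (A : category) (x y z : A) (f : hom y z) (g : hom x y) (g' : hom y x)
    (f' : hom z y) : ccomp g g' = cid y -> ccomp f f' = cid z ->
    ccomp (ccomp f g) (ccomp g' f') = cid z.
  by move=> gK fK; rewrite -ccompA (ccompA g) gK ccomp1f.
exists (functor_comp F' F), (functor_comp G G'); split; constructor.
- refine (@NatIso _ _ (functor_comp (functor_comp G G') (functor_comp F' F))
    (functor_id C)
    (fun a => ccomp (nat_fwd i a) (fmap G (nat_fwd i' (F a))))
    (fun a => ccomp (fmap G (nat_bwd i' (F a))) (nat_bwd i a)) _ _ _).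
  + move=> a b f; have /= e := nat_natural i f; have /= e' := nat_natural i' (fmap F f).
    by rewrite /= ccompA e -!ccompA -!fmapM e'.
  + move=> a; apply: midK; first exact: (nat_fwdK i).
    exact: (fmapK _ _ G _ _ _ _ (nat_fwdK i' (F a))).
  + move=> a; apply: midK; last exact: (nat_bwdK i).
    exact: (fmapK _ _ G _ _ _ _ (nat_bwdK i' (F a))).
refine (@NatIso _ _ (functor_comp (functor_comp F' F) (functor_comp G G'))
    (functor_id E)
    (fun a => ccomp (nat_fwd j' a) (fmap F' (nat_fwd j (G' a))))
    (fun a => ccomp (fmap F' (nat_bwd j (G' a))) (nat_bwd j' a)) _ _ _).
+ move=> a b f; have /= e := nat_natural j' f; have /= e' := nat_natural j (fmap G' f).
  by rewrite /= ccompA e -!ccompA -!fmapM e'.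
+ move=> a; apply: midK; first exact: (nat_fwdK j').
  exact: (fmapK _ _ F' _ _ _ _ (nat_fwdK j (G' a))).
+ move=> a; apply: midK; last exact: (nat_bwdK j').
  exact: (fmapK _ _ F' _ _ _ _ (nat_bwdK j (G' a))).
Qed.

End EquivalenceTrans.

(** * Exchanging the factors of a tensor product *)

Section Flip.
Variable K : fieldType.
Implicit Types U V W X Y Z : lmodType K.

Definition tflip_fun V W (t : V ⨂ W) : W ⨂ V := \sw_(v, w <- t) (w ⊗ v).

Lemma tflip_is_linear V W : linear (@tflip_fun V W).
Proof. by rewrite /tflip_fun; multilin. Qed.

HB.instance Definition _ V W := GRing.isLinear.Build K (V ⨂ W) (W ⨂ V) *:%R
  (@tflip_fun V W) (@tflip_is_linear V W).

Definition tflip V W : {linear V ⨂ W -> W ⨂ V} := @tflip_fun V W.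

Lemma tflip_tens V W (v : V) (w : W) : tflip V W (v ⊗ w) = w ⊗ v.
Proof. by rewrite /= /tflip_fun tlift_tens //; multilin. Qed.

Lemma tflipK V W : cancel (tflip V W) (tflip W V).
Proof. by apply: tens_ext => [||v w]; rewrite ?tflip_tens //; multilin. Qed.

Lemma tlift_tflip V W U (F : W -> V -> U) t : is_bilinear F ->
  \sw_(w, v <- tflip V W t) F w v = \sw_(v, w <- t) F w v.
Proof. exact: tlift_tlift. Qed.

Lemma tflip_tmap V W V' W' (f : {linear V -> V'}) (g : {linear W -> W'}) t :
  tflip V' W' (tmap f g t) = tmap g f (tflip V W t).
Proof.
move: t; apply: tens_ext => [||v w]; try by multilin.
by rewrite tmap_tens !tflip_tens tmap_tens.
Qed.

(** Flipping reverses the order of the three legs, so [f] and [g] trade places; the proof tests the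
    given identity on [w ⊗ (v ⊗ u)]. *)
Lemma tflip_coassoc U V W Y Z (f : {linear Y -> U ⨂ V})
    (g : {linear Z -> V ⨂ W}) (t : Y ⨂ W) (t' : U ⨂ Z) :
  tassoc (tmap f idfun t) = tmap idfun g t' ->
  tassoc (tmap (lin_comp (tflip _ _) g) idfun (tflip _ _ t')) =
  tmap idfun (lin_comp (tflip _ _) f) (tflip _ _ t).
Proof.
move=> e; apply: sweedler_coassoc; rewrite !tlift_tflip; try by multilin.
under eq_tlift => u z do [rewrite /= tlift_tflip; last by multilin].
under [RHS]eq_tlift => y w do [rewrite /= tlift_tflip; last by multilin].
by rewrite (coassoc_sweedler e (T := fun u v w => w ⊗ (v ⊗ u))) //; multilin.
Qed.

End Flip.

(** * The opposite co-opposite Hopf quasigroup *)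

Section Opposite.
Variables (K : fieldType) (H : hopfQuasigroup K).

Local Notation "x ** y" := (hq_mul H (x ⊗ y)) (at level 40).
Local Notation Δ := (hq_comul H).
Local Notation ε := (hq_counit H).
Local Notation S := (hq_antipode H).

Let mulo : {linear H ⨂ H -> H} := lin_comp (hq_mul H) (tflip H H).
Let comulo : {linear H -> H ⨂ H} := lin_comp (tflip H H) Δ.

Fact muloE g h : mulo (g ⊗ h) = h ** g.
Proof. by rewrite /mulo [LHS](congr1 (hq_mul H) (tflip_tens _ _)). Qed.

Fact tlift_comulo (U : lmodType K) (F : H -> H -> U) h : is_bilinear F ->
  \sw_(h1, h2 <- comulo h) F h1 h2 = \sw_(h1, h2 <- Δ h) F h2 h1.
Proof. exact: tlift_tflip. Qed.

Fact opcop_mul1h h : mulo (hq_one H ⊗ h) = h.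
Proof. by rewrite muloE hq_mulh1. Qed.

Fact opcop_mulh1 h : mulo (h ⊗ hq_one H) = h.
Proof. by rewrite muloE hq_mul1h. Qed.

Fact opcop_coassoc h :
  tassoc (tmap comulo idfun (comulo h)) = tmap idfun comulo (comulo h).
Proof. exact: tflip_coassoc (hq_coassoc h). Qed.

Fact opcop_counitl h : \sw_(h1, h2 <- comulo h) (ε h1 *: h2) = h.
Proof. by rewrite tlift_comulo ?hq_counitr //; multilin. Qed.

Fact opcop_counitr h : \sw_(h1, h2 <- comulo h) (ε h2 *: h1) = h.
Proof. by rewrite tlift_comulo ?hq_counitl //; multilin. Qed.

Fact opcop_comul1 : comulo (hq_one H) = hq_one H ⊗ hq_one H.
Proof. by rewrite /comulo [LHS](congr1 (tflip H H) (hq_comul1 H)) tflip_tens. Qed.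

Fact opcop_comulM g h : comulo (mulo (g ⊗ h)) =
  \sw_(g1, g2 <- comulo g) \sw_(h1, h2 <- comulo h)
    (mulo (g1 ⊗ h1) ⊗ mulo (g2 ⊗ h2)).
Proof.
rewrite muloE [LHS](congr1 (tflip H H) (hq_comulM h g)).
rewrite tlift_comulo; last by multilin.
under [RHS]eq_tlift => g1 g2 do [rewrite tlift_comulo; last by multilin].
rewrite exchange_tlift linear_tlift; apply: eq_tlift => h1 h2.
rewrite linear_tlift; apply: eq_tlift => g1 g2.
by rewrite tflip_tens !muloE.
Qed.

Fact opcop_counitM g h : ε (mulo (g ⊗ h)) = ε g * ε h.
Proof. by rewrite muloE hq_counitM mulrC. Qed.

(** Reversing both product and coproduct keeps [S] as the antipode: in this and the next three
    facts, left antipode laws come from right ones and conversely. *)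
Fact opcop_antipodeKl g h :
  \sw_(h1, h2 <- comulo h) mulo (S h1 ⊗ mulo (h2 ⊗ g)) = ε h *: g.
Proof.
rewrite tlift_comulo; last by multilin.
by under eq_tlift => h1 h2 do rewrite !muloE; rewrite hq_antipodeKr.
Qed.

Fact opcop_antipodeVKl g h :
  \sw_(h1, h2 <- comulo h) mulo (h1 ⊗ mulo (S h2 ⊗ g)) = ε h *: g.
Proof.
rewrite tlift_comulo; last by multilin.
by under eq_tlift => h1 h2 do rewrite !muloE; rewrite hq_antipodeVKr.
Qed.

Fact opcop_antipodeKr g h :
  \sw_(h1, h2 <- comulo h) mulo (mulo (g ⊗ h1) ⊗ S h2) = ε h *: g.
Proof.
rewrite tlift_comulo; last by multilin.
by under eq_tlift => h1 h2 do rewrite !muloE; rewrite hq_antipodeKl.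
Qed.

Fact opcop_antipodeVKr g h :
  \sw_(h1, h2 <- comulo h) mulo (mulo (g ⊗ S h1) ⊗ h2) = ε h *: g.
Proof.
rewrite tlift_comulo; last by multilin.
by under eq_tlift => h1 h2 do rewrite !muloE; rewrite hq_antipodeVKl.
Qed.

Definition opcop : hopfQuasigroup K :=
  HopfQuasigroup opcop_mul1h opcop_mulh1 opcop_coassoc opcop_counitl
    opcop_counitr opcop_comul1 opcop_comulM (hq_counit1 H) opcop_counitM
    opcop_antipodeKl opcop_antipodeVKl opcop_antipodeKr opcop_antipodeVKr.

(** * Left modules over [H] as right modules over [opcop] *)

Section LeftToRight.
Variable M : leftHopfModule H.

Let coact : {linear M -> M ⨂ opcop} := lin_comp (tflip H M) (lhm_coact M).
Let act : {linear M ⨂ opcop -> M} := lin_comp (lhm_act M) (tflip M H).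

Fact right_actE m (h : H) : act (m ⊗ h) = lhm_act M (h ⊗ m).
Proof. by rewrite /act [LHS](congr1 (lhm_act M) (tflip_tens _ _)). Qed.

Fact tlift_right_coact (U : lmodType K) (F : M -> H -> U) m : is_bilinear F ->
  \sw_(m0, m1 <- coact m) F m0 m1 = \sw_(m1, m0 <- lhm_coact M m) F m0 m1.
Proof. exact: tlift_tflip. Qed.

Fact right_coassoc m :
  tassoc (tmap coact idfun (coact m)) = tmap idfun comulo (coact m).
Proof. exact: tflip_coassoc (lhm_coassoc m). Qed.

Fact right_counit m : \sw_(m0, m1 <- coact m) (ε m1 *: m0) = m.
Proof. by rewrite tlift_right_coact ?lhm_counit //; multilin. Qed.

Fact right_act1 m : act (m ⊗ hq_one H) = m.
Proof. by rewrite right_actE lhm_act1. Qed.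

Fact right_actK m h :
  \sw_(h1, h2 <- comulo h) act (act (m ⊗ h1) ⊗ S h2) = ε h *: m.
Proof.
rewrite tlift_comulo; last by multilin.
by under eq_tlift => h1 h2 do rewrite !right_actE; rewrite lhm_actK.
Qed.

Fact right_actVK m h :
  \sw_(h1, h2 <- comulo h) act (act (m ⊗ S h1) ⊗ h2) = ε h *: m.
Proof.
rewrite tlift_comulo; last by multilin.
by under eq_tlift => h1 h2 do rewrite !right_actE; rewrite lhm_actVK.
Qed.

Fact right_coactM m (h : H) : coact (act (m ⊗ h)) =
  \sw_(m0, m1 <- coact m) \sw_(h1, h2 <- comulo h)
    (act (m0 ⊗ h1) ⊗ mulo (m1 ⊗ h2)).
Proof.
rewrite right_actE [LHS](congr1 (tflip H M) (@lhm_coactM K H M h m)).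
rewrite tlift_right_coact; last by multilin.
under [RHS]eq_tlift => m1 m0 do [rewrite tlift_comulo; last by multilin].
rewrite exchange_tlift linear_tlift; apply: eq_tlift => h1 h2.
rewrite linear_tlift; apply: eq_tlift => m1 m0.
by rewrite tflip_tens right_actE muloE.
Qed.

Definition right_of_left : rightHopfModule opcop :=
  @RightHopfModule K opcop M coact act right_coassoc right_counit right_act1
    right_actK right_actVK right_coactM.

(** The iterated coaction is read in reverse order and every product is reversed, so the two induced
    actions are the same map. Hence quasilinearity means the same on both sides. *)
Lemma right_of_left_induced (m : M) (h : H) :
  rhm_induced (M := right_of_left) m h = @lhm_induced K H M h m.
Proof.
rewrite /rhm_induced /lhm_induced !tlift_tmap; try by multilin.
rewrite tlift_right_coact; last by multilin.
apply: eq_tlift => y m0; rewrite tlift_comulo; last by multilin.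
apply: eq_tlift => m2 m1. by rewrite right_actE muloE right_actE.
Qed.

End LeftToRight.

(** * Right modules over [opcop] as left modules over [H] *)

Section RightToLeft.
Variable M : rightHopfModule opcop.

Let coact : {linear M -> H ⨂ M} := lin_comp (tflip M H) (rhm_coact M).
Let act : {linear H ⨂ M -> M} := lin_comp (rhm_act M) (tflip H M).

Fact left_actE (h : H) m : act (h ⊗ m) = rhm_act M (m ⊗ h).
Proof. by rewrite /act [LHS](congr1 (rhm_act M) (tflip_tens _ _)). Qed.

Fact tlift_left_coact (U : lmodType K) (F : H -> M -> U) m : is_bilinear F ->
  \sw_(m1, m0 <- coact m) F m1 m0 = \sw_(m0, m1 <- rhm_coact M m) F m1 m0.
Proof. exact: tlift_tflip. Qed.

(** [tflip_coassoc] would yield the twice flipped coproduct in place of [Δ], so the legs are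
    reversed directly in Sweedler form. *)
Fact left_coassoc m :
  tassoc (tmap Δ idfun (coact m)) = tmap idfun coact (coact m).
Proof.
apply: sweedler_coassoc; rewrite !tlift_left_coact; try by multilin.
under [RHS]eq_tlift => n h do [rewrite tlift_left_coact; last by multilin].
rewrite (coassoc_sweedler (rhm_coassoc m) (T := fun w v h => h ⊗ (v ⊗ w))).
  by apply: eq_tlift => m0 y; rewrite tlift_comulo //; multilin.
by multilin.
Qed.

Fact left_counit m : \sw_(m1, m0 <- coact m) (ε m1 *: m0) = m.
Proof. by rewrite tlift_left_coact ?(rhm_counit m) //; multilin. Qed.

Fact left_act1 m : act (hq_one H ⊗ m) = m.
Proof. by rewrite left_actE (rhm_act1 m). Qed.

Fact left_actK h m :
  \sw_(h1, h2 <- Δ h) act (S h1 ⊗ act (h2 ⊗ m)) = ε h *: m.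
Proof.
rewrite -(rhm_actK m h) tlift_comulo; last by multilin.
by apply: eq_tlift => h1 h2; rewrite !left_actE.
Qed.

Fact left_actVK h m :
  \sw_(h1, h2 <- Δ h) act (h1 ⊗ act (S h2 ⊗ m)) = ε h *: m.
Proof.
rewrite -(rhm_actVK m h) tlift_comulo; last by multilin.
by apply: eq_tlift => h1 h2; rewrite !left_actE.
Qed.

Fact left_coactM h m : coact (act (h ⊗ m)) =
  \sw_(h1, h2 <- Δ h) \sw_(m1, m0 <- coact m)
    ((h1 ** m1) ⊗ act (h2 ⊗ m0)).
Proof.
rewrite left_actE [LHS](congr1 (tflip M H) (rhm_coactM m h)).
under [RHS]eq_tlift => h1 h2 do [rewrite tlift_left_coact; last by multilin].
rewrite exchange_tlift linear_tlift; apply: eq_tlift => m0 m1.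
rewrite linear_tlift tlift_comulo; last by multilin.
by apply: eq_tlift => h1 h2; rewrite tflip_tens left_actE muloE.
Qed.

Definition left_of_right : leftHopfModule H :=
  @LeftHopfModule K H M coact act left_coassoc left_counit left_act1
    left_actK left_actVK left_coactM.

Lemma left_of_right_induced (h : H) (m : M) :
  lhm_induced (M := left_of_right) h m = @rhm_induced K opcop M m h.
Proof.
rewrite /rhm_induced /lhm_induced !tlift_tmap; try by multilin.
rewrite tlift_left_coact; last by multilin.
apply: eq_tlift => m0 y; rewrite tlift_comulo; last by multilin.
by apply: eq_tlift => m2 m1; rewrite left_actE muloE left_actE.
Qed.

End RightToLeft.

Section RightOfLeftMap.
Variables (M N : leftHopfModule H) (f : lhm_hom M N).

Let g : {linear right_of_left M -> right_of_left N} := lhm_fun f.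

Fact right_of_left_colinear : right_colinear g.
Proof.
move=> m; rewrite [LHS](congr1 (tflip H N) (lhm_funC f m)).
exact: tflip_tmap.
Qed.

Fact right_of_left_quasilinear : right_quasilinear g.
Proof. by move=> m h; rewrite !right_of_left_induced [LHS](lhm_funQ f). Qed.

Definition right_of_left_map : rhm_hom (right_of_left M) (right_of_left N) :=
  RhmHom right_of_left_colinear right_of_left_quasilinear.

End RightOfLeftMap.

Section LeftOfRightMap.
Variables (M N : rightHopfModule opcop) (f : rhm_hom M N).

Let g : {linear left_of_right M -> left_of_right N} := rhm_fun f.

Fact left_of_right_colinear : left_colinear g.
Proof.
move=> m; rewrite [LHS](congr1 (tflip N H) (rhm_funC f m)).
exact: tflip_tmap.
Qed.

Fact left_of_right_quasilinear : left_quasilinear g.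
Proof. by move=> h m; rewrite !left_of_right_induced [LHS](rhm_funQ f). Qed.

Definition left_of_right_map : lhm_hom (left_of_right M) (left_of_right N) :=
  LhmHom left_of_right_colinear left_of_right_quasilinear.

End LeftOfRightMap.

(** * The functors exchanging left and right modules, and their round trips *)

Definition right_of_left_obj (M : leftHopfModCat H) : rightHopfModCat opcop :=
  right_of_left M.

Definition left_of_right_obj (M : rightHopfModCat opcop) : leftHopfModCat H :=
  left_of_right M.

Definition right_of_left_functor :
  functor (leftHopfModCat H) (rightHopfModCat opcop).
Proof.
refine (@Functor (leftHopfModCat H) (rightHopfModCat opcop) right_of_left_obj
  (fun M N f => right_of_left_map f) _ _).
- by move=> M; apply: rhm_hom_ext.
- by move=> M N P f g; apply: rhm_hom_ext.
Defined.

Definition left_of_right_functor :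
  functor (rightHopfModCat opcop) (leftHopfModCat H).
Proof.
refine (@Functor (rightHopfModCat opcop) (leftHopfModCat H) left_of_right_obj
  (fun M N f => left_of_right_map f) _ _).
- by move=> M; apply: lhm_hom_ext.
- by move=> M N P f g; apply: lhm_hom_ext.
Defined.

(** The round trip flips the coaction twice and so agrees with the original pointwise. This allows
    the identity map of the underlying space to be a morphism in either direction. *)
Lemma left_of_rightK_coact (M : leftHopfModule H) (m : M) :
  lhm_coact (left_of_right (right_of_left M)) m = lhm_coact M m.
Proof. exact: tflipK. Qed.

Lemma right_of_leftK_coact (M : rightHopfModule opcop) (m : M) :
  rhm_coact (right_of_left (left_of_right M)) m = rhm_coact M m.
Proof. exact: tflipK. Qed.

Lemma left_of_rightK_induced (M : leftHopfModule H) (h : H) (m : M) :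
  lhm_induced (M := left_of_right (right_of_left M)) h m = @lhm_induced K H M h m.
Proof. by rewrite left_of_right_induced right_of_left_induced. Qed.

Lemma right_of_leftK_induced (M : rightHopfModule opcop) (m : M) (h : H) :
  rhm_induced (M := right_of_left (left_of_right M)) m h = @rhm_induced K opcop M m h.
Proof. by rewrite right_of_left_induced left_of_right_induced. Qed.

Definition left_of_rightK_fwd (M : leftHopfModule H) :
  lhm_hom (left_of_right (right_of_left M)) M.
Proof.
apply: (@LhmHom K H (left_of_right (right_of_left M)) M (lin_id M)).
- move=> m; rewrite left_of_rightK_coact; exact/esym/tmap_id.
- by move=> h m; rewrite left_of_rightK_induced.
Defined.

Definition left_of_rightK_bwd (M : leftHopfModule H) :
  lhm_hom M (left_of_right (right_of_left M)).
Proof.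
apply: (@LhmHom K H M (left_of_right (right_of_left M)) (lin_id M)).
- move=> m; rewrite left_of_rightK_coact; exact/esym/tmap_id.
- by move=> h m; rewrite left_of_rightK_induced.
Defined.

Definition right_of_leftK_fwd (M : rightHopfModule opcop) :
  rhm_hom (right_of_left (left_of_right M)) M.
Proof.
apply: (@RhmHom K opcop (right_of_left (left_of_right M)) M (lin_id M)).
- move=> m; rewrite right_of_leftK_coact; exact/esym/tmap_id.
- by move=> m h; rewrite right_of_leftK_induced.
Defined.

Definition right_of_leftK_bwd (M : rightHopfModule opcop) :
  rhm_hom M (right_of_left (left_of_right M)).
Proof.
apply: (@RhmHom K opcop M (right_of_left (left_of_right M)) (lin_id M)).
- move=> m; rewrite right_of_leftK_coact; exact/esym/tmap_id.
- by move=> m h; rewrite right_of_leftK_induced.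
Defined.

Lemma left_right_opcop_equivalence :
  equivalent_categories (leftHopfModCat H) (rightHopfModCat opcop).
Proof.
exists right_of_left_functor, left_of_right_functor; split; constructor.
(* All components are identities on vectors, so naturality and both cancellation laws hold
   pointwise. *)
- refine (@NatIso _ _ (functor_comp left_of_right_functor right_of_left_functor)
    (functor_id _) (fun M => left_of_rightK_fwd M)
    (fun M => left_of_rightK_bwd M) _ _ _) => *.
  + by apply/lhm_hom_ext/linear_map_ext.
  + by apply/lhm_hom_ext/linear_map_ext.
  + by apply/lhm_hom_ext/linear_map_ext.
refine (@NatIso _ _ (functor_comp right_of_left_functor left_of_right_functor)
  (functor_id _) (fun M => right_of_leftK_fwd M)
  (fun M => right_of_leftK_bwd M) _ _ _) => *.
+ by apply/rhm_hom_ext/linear_map_ext.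
+ by apply/rhm_hom_ext/linear_map_ext.
+ by apply/rhm_hom_ext/linear_map_ext.
Qed.

End Opposite.

Theorem theorem3p6 (K : fieldType) (H : hopfQuasigroup K) :
  equivalent_categories (rightHopfModCat H) (vectCat K) /\
  equivalent_categories (leftHopfModCat H) (vectCat K).
Proof.
split; first exact: right_equivalence.
apply: equivalent_categories_trans (left_right_opcop_equivalence H) _.
exact: right_equivalence.
Qed.
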